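(* Let $k\ge 2$ be fixed, $N=kn$, and $p=\Omega(1/\log n)$. Let $G$ be a random graph from the $G(N,p)$ model conditioned on being connected, and let $T$ be a uniformly random spanning tree of $G$. Then the probability that $T$ is $k$-splittable is at least $C_k\, n^{\frac{1-k}{2}}\, p\, e^{-(2+o(1))/p}$, and in particular at least $C_k n^{-\frac k2-O(1)}$, where $C_k>0$ depends only on $k$ and $o(1)\to0$ as $n\to\infty$.
   Context: A tree $T$ is $k$-splittable if there exist $k-1$ edges of $T$ whose removal leaves a forest whose $k$ connected components all have the same number of vertices. $G(N,p)$ is the random graph on $N$ labeled vertices in which each edge is present independently with probability $p$. The probability is taken over both $G$ and $T$, i.e. it equals $\mathbb{E}_G[\tau_k(G)/\tau(G)]$, where $\tau(G)$ is the number of spanning trees of $G$ and $\tau_k(G)$ the number of $k$-splittable spanning trees of $G$. *)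

(* Defs.v *)
From HB Require Import structures.
From mathcomp Require Import all_boot all_order all_algebra.
From mathcomp Require Import all_classical all_reals all_analysis.
Set Implicit Arguments. Unset Strict Implicit. Unset Printing Implicit Defensive.
Import Order.TTheory GRing.Theory Num.Theory.
Local Open Scope ring_scope.

Section Graphs.
Variable N : nat.

Definition all_edges : {set {set 'I_N}} := [set e : {set 'I_N} | #|e| == 2%N].

(* A (simple) graph on 'I_N is given by its edge set E \subset all_edges. *)
Definition adj (E : {set {set 'I_N}}) : rel 'I_N := fun x y => [set x; y] \in E.

Definition connectedE (E : {set {set 'I_N}}) : Prop :=
  forall x y : 'I_N, connect (adj E) x y.

(* acyclic: no edge lies on a cycle, i.e. removing any edge {x,y}
   disconnects x from y *)
Definition acyclicE (E : {set {set 'I_N}}) : Prop :=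
  forall x y : 'I_N, [set x; y] \in E -> ~~ connect (adj (E :\ [set x; y])) x y.

Definition spanning_tree (G T : {set {set 'I_N}}) : Prop :=
  T \subset G /\ connectedE T /\ acyclicE T.

Definition component (E : {set {set 'I_N}}) (x : 'I_N) : {set 'I_N} :=
  [set y | connect (adj E) x y].

Definition k_splittable (k : nat) (T : {set {set 'I_N}}) : Prop :=
  exists S : {set {set 'I_N}},
    [/\ S \subset T, #|S| = k.-1 &
        forall x y : 'I_N, #|component (T :\: S) x| = #|component (T :\: S) y| ].

Definition tau (G : {set {set 'I_N}}) : nat :=
  #|[set T : {set {set 'I_N}} | `[< spanning_tree G T >] ]|.

Definition tau_k (k : nat) (G : {set {set 'I_N}}) : nat :=
  #|[set T : {set {set 'I_N}} | `[< spanning_tree G T /\ k_splittable k T >] ]|.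

Definition graphs : {set {set {set 'I_N}}} :=
  [set G : {set {set 'I_N}} | G \subset all_edges].

Definition connected_graphs : {set {set {set 'I_N}}} :=
  [set G in graphs | `[< connectedE G >] ].

Definition gnp_weight {R : realType} (p : R) (G : {set {set 'I_N}}) : R :=
  p ^+ #|G| * (1 - p) ^+ (#|all_edges| - #|G|).

(* P(T is k-splittable) where G ~ G(N,p) conditioned on being connected and
   T is a uniform spanning tree of G;  = E_G[tau_k(G)/tau(G) | G connected]. *)
Definition split_prob_N {R : realType} (k : nat) (p : R) : R :=
  (\sum_(G in connected_graphs) gnp_weight p G * ((tau_k k G)%:R / (tau G)%:R))
  / (\sum_(G in connected_graphs) gnp_weight p G).

End Graphs.

Definition split_prob {R : realType} (k n : nat) (p : R) : R :=
  @split_prob_N (k * n)%N R k p.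

(* Main.v *)
Require Import Defs.
From HB Require Import structures.
From mathcomp Require Import all_boot all_order all_algebra.
From mathcomp Require Import all_classical all_reals all_analysis.
(* Re-imported so that the finite-set names win over the classical-set ones. *)
From mathcomp Require Import fintype finset fingraph zify ring lra.
Set Implicit Arguments. Unset Strict Implicit. Unset Printing Implicit Defensive.
Import Order.TTheory GRing.Theory Num.Theory.
Local Open Scope ring_scope.

(** Fix a tree [T] and put [x = 1/p].  Given [T \subset G], the mean of [tau G]
    is [p^(N-1)] times the sum of [x^|T :&: T'|] over all labelled trees [T'], so
    by Jensen [T] contributes at least the inverse of that sum to
    [E (tau_k / tau)].  Expanding in powers of [x - 1], the sum is
    [\sum_(F \subset T) (x - 1)^|F| t_F], where the number [t_F] of labelled trees
    containing the forest [F] is [N^(c-2)] times the product of the sizes of its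
    [c] components.  This product is at most [2^|F|], so the sum is at most
    [N^(N-2) exp (2 (x - 1))] whatever [T] is; in particular the error term
    [eps = 0] works.  The formula for [t_F], applied to blocks of size [n] and
    then to the whole vertex set, also shows that the proportion of
    [k]-splittable labelled trees is at least [(kn)! / (n!^k k^(kn))], which is
    at least [k!/k^k n^((1-k)/2)]. *)

(** * Forests and their components *)

Section Forests.
Variable N : nat.
Implicit Types (E F T : {set {set 'I_N}}) (x y u v : 'I_N).

(** A boolean form of [acyclicE], so that forests can be gathered in finite sets and counted. *)
Definition forest E : bool :=
  (E \subset all_edges N) &&
  [forall x, forall y, ([set x; y] \in E) ==>
     ~~ connect (adj (E :\ [set x; y])) x y].

Definition comps E : {set {set 'I_N}} := [set component E x | x : 'I_N].

Definition compsize_prod E : nat := \prod_(C in comps E) #|C|.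

Lemma forestP E :
  reflect (E \subset all_edges N /\ acyclicE E) (forest E).
Proof.
apply: (iffP andP) => -[sE aE]; split=> //.
  by move=> x y; move/forallP: aE => /(_ x)/forallP/(_ y)/implyP.
by apply/forallP=> x; apply/forallP=> y; apply/implyP; apply: aE.
Qed.

Lemma adj_sym E : symmetric (adj E).
Proof. by move=> x y; rewrite /adj setUC. Qed.

Lemma connect_adj_sym E : connect_sym (adj E).
Proof. exact: sym_connect_sym (adj_sym E). Qed.

Lemma connect_adjS E F x y :
  E \subset F -> connect (adj E) x y -> connect (adj F) x y.
Proof.
by move=> sEF; apply: connect_sub => a b ab; apply/connect1/(subsetP sEF).
Qed.

Lemma in_component E x y : (y \in component E x) = connect (adj E) x y.
Proof. by rewrite inE. Qed.

Lemma component_refl E x : x \in component E x.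
Proof. by rewrite in_component connect0. Qed.

Lemma component_eq E x y :
  (component E x == component E y) = connect (adj E) x y.
Proof.
apply/eqP/idP => [eC|cxy].
  by rewrite -in_component eC component_refl.
by apply/setP => z; rewrite !in_component (same_connect (connect_adj_sym E) cxy).
Qed.

Lemma card_component_gt0 E x : (0 < #|component E x|)%N.
Proof. by apply/card_gt0P; exists x; apply: component_refl. Qed.

Lemma forest_edge_size E e : forest E -> e \in E -> #|e| = 2%N.
Proof. by case/forestP=> /subsetP sE _ /sE; rewrite inE => /eqP. Qed.

Lemma forest_sub E F : F \subset E -> forest E -> forest F.
Proof.
move=> sFE /forestP[sE aE]; apply/forestP; split; first exact: subset_trans sE.
move=> x y xyF; apply: contra (aE x y (subsetP sFE _ xyF)).
by apply: connect_adjS; apply: setSD.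
Qed.

Lemma connect_setU1 E u v x y :
  connect (adj ([set u; v] |: E)) x y =
  [|| connect (adj E) x y, connect (adj E) x u && connect (adj E) v y
    | connect (adj E) x v && connect (adj E) u y].
Proof.
set E' := _ |: E.
have sE : E \subset E' by apply: subsetUr.
have uvE' : connect (adj E') u v by apply/connect1; rewrite /adj !inE eqxx.
have vuE' : connect (adj E') v u by rewrite connect_adj_sym.
apply/idP/idP; last first.
  case/or3P => [|/andP[xu vy]|/andP[xv uy]]; first exact: connect_adjS.
    apply: connect_trans (connect_adjS sE xu) _.
    exact: connect_trans uvE' (connect_adjS sE vy).
  apply: connect_trans (connect_adjS sE xv) _.
  exact: connect_trans vuE' (connect_adjS sE uy).
(* [Q] is the right-hand side as a predicate of the endpoint. It holds at [x] and is closed under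
   adjacency in [E'], so it holds along every path from [x]. *)
pose Q := [pred z | [|| connect (adj E) x z,
  connect (adj E) x u && connect (adj E) v z
  | connect (adj E) x v && connect (adj E) u z]].
move=> cxy; suff : closed (adj E') Q.
  by move/closed_connect/(_ _ _ cxy); rewrite !inE connect0 => /esym.
apply: (intro_closed (connect_adj_sym E')) => a b.
rewrite /adj !inE => /orP[/eqP abuv | abE]; last first.
  have ab : connect (adj E) a b by apply: connect1.
  case/or3P => [xa|/andP[-> va]|/andP[-> ua]].
  - by rewrite (connect_trans xa ab).
  - by rewrite (connect_trans va ab) !orbT.
  - by rewrite (connect_trans ua ab) !orbT.
have : b \in [set u; v] by rewrite -abuv !inE eqxx orbT.
have : a \in [set u; v] by rewrite -abuv !inE eqxx.
rewrite !inE => /orP[]/eqP-> /orP[]/eqP-> //; rewrite !connect0 ?andbT.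
  by case/or3P => [->|/andP[-> _]|->]; rewrite ?orbT.
by case/or3P => [->|->|/andP[-> _]]; rewrite ?orbT.
Qed.

Lemma forest_setU1 E u v :
  forest E -> ~~ connect (adj E) u v -> forest ([set u; v] |: E).
Proof.
move=> /forestP[sE aE] nuv; apply/forestP; split.
  rewrite subUset sE andbT sub1set inE cards2.
  by have [uv|//] := eqVneq u v; rewrite uv connect0 in nuv.
move=> x y; rewrite in_setU1 => /orP[/eqP xyuv|xyE].
  apply: contra nuv; rewrite xyuv.
  have sub : ([set u; v] |: E) :\ [set u; v] \subset E.
    by apply/subsetP => z; rewrite !inE => /andP[/negPf-> ].
  move=> /(connect_adjS sub) cxy.
  have : u \in [set x; y] by rewrite xyuv !inE eqxx.
  have : v \in [set x; y] by rewrite xyuv !inE eqxx orbT.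
  rewrite !inE => /orP[]/eqP-> /orP[]/eqP-> //; rewrite ?connect0 //.
  by rewrite connect_adj_sym.
have neuv : [set x; y] != [set u; v].
  apply: contraNneq nuv => xyuv; apply: connect1.
  by rewrite /adj -xyuv.
have -> : ([set u; v] |: E) :\ [set x; y] = [set u; v] |: (E :\ [set x; y]).
  apply/setP=> z; rewrite !inE; case: (eqVneq z [set u; v]) => // ->.
  by rewrite eq_sym neuv.
have sub : E :\ [set x; y] \subset E by apply: subD1set.
have cxy : connect (adj E) x y by apply: connect1.
(* A cycle through the old edge [xy] would have to use [uv]; the rest of it together with [xy] would
   join [u] to [v] inside [E]. *)
rewrite connect_setU1 (negPf (aE x y xyE)) /=.
apply/negP => /orP[]/andP[] /(connect_adjS sub) c1 /(connect_adjS sub) c2;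
  apply/negP: nuv; rewrite negbK.
  apply: (@connect_trans _ _ x); first by rewrite connect_adj_sym.
  by apply: (connect_trans cxy); rewrite connect_adj_sym.
apply: (connect_trans c2); rewrite connect_adj_sym in cxy.
exact: (connect_trans cxy).
Qed.

Lemma forest0 : forest set0.
Proof. by apply/forestP; split; [apply: sub0set | move=> x y; rewrite inE]. Qed.

(** Removing any edge of a forest disconnects its ends, so every forest is built from the empty one
    by edges that merge two components. *)
Lemma forest_ind (Q : {set {set 'I_N}} -> Prop) :
  Q set0 ->
  (forall F u v, forest F -> ~~ connect (adj F) u v -> Q F ->
     Q ([set u; v] |: F)) ->
  forall F, forest F -> Q F.
Proof.
move=> Q0 QS F; have [n] := ubnP #|F|; elim: n F => // n IHn F ltFn fF.
have [-> //|[e eF]] := set_0Vmem F.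
have : #|e| == 2%N by rewrite (forest_edge_size fF eF).
case/cards2P => u [v [nuv defe]].
rewrite -(setD1K eF) defe.
have fD : forest (F :\ e) by apply: forest_sub fF; apply: subD1set.
rewrite -defe {1}defe; apply: QS => //.
  have /forestP[_] := fF; rewrite defe; apply; by rewrite -defe.
by apply: IHn => //; rewrite (cardsD1 e) eF in ltFn.
Qed.

Lemma component_setU1 E u v x :
  component ([set u; v] |: E) x =
  if (x \in component E u) || (x \in component E v)
  then component E u :|: component E v else component E x.
Proof.
apply/setP => y; rewrite [LHS]in_component connect_setU1 !in_component.
rewrite (connect_adj_sym E x u) (connect_adj_sym E x v).
case ux: (connect (adj E) u x); case vx: (connect (adj E) v x) => /=.
- rewrite !inE (same_connect (connect_adj_sym E) ux).
  rewrite (same_connect (connect_adj_sym E) vx).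
  by case: (connect _ _ _).
- rewrite !inE (same_connect (connect_adj_sym E) ux).
  by rewrite orbF.
- rewrite !inE (same_connect (connect_adj_sym E) vx).
  by rewrite orbC.
- by rewrite !inE orbF.
Qed.

Section Merge.
Variables (E : {set {set 'I_N}}) (u v : 'I_N).
Hypothesis nuv : ~~ connect (adj E) u v.
Let A := component E u.
Let B := component E v.

Lemma comps_setU1 : comps ([set u; v] |: E) = (A :|: B) |: (comps E :\ A :\ B).
Proof.
apply/setP => C; rewrite !inE; apply/imsetP/orP.
  move=> [x _ ->]; rewrite component_setU1.
  case: ifPn => [_|]; first by left.
  rewrite negb_or !in_component => /andP[nux nvx]; right.
  by rewrite imset_f // !component_eq ![connect _ x _]connect_adj_sym nux nvx.
case=> [/eqP->|/and3P[CB CA /imsetP[x _ CE]]].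
  by exists u => //; rewrite component_setU1 component_refl.
exists x => //; rewrite component_setU1 !in_component -!component_eq -CE.
by rewrite ![_ == C]eq_sym (negPf CA) (negPf CB).
Qed.

Lemma mergeA : A \in comps E. Proof. exact: imset_f. Qed.

Lemma mergeB : B \in comps E :\ A.
Proof. by rewrite !inE imset_f // component_eq connect_adj_sym nuv. Qed.

Lemma mergeAB : A :|: B \notin comps E :\ A :\ B.
Proof.
rewrite !inE; apply/negP => /and3P[nB nA /imsetP[x _ ABx]].
have : u \in component E x by rewrite -ABx inE component_refl.
have : v \in component E x by rewrite -ABx inE component_refl orbT.
rewrite !in_component => xv xu; case/negP: nuv.
by apply: connect_trans xv; rewrite connect_adj_sym.
Qed.

Lemma card_comps_setU1 : #|comps E| = #|comps ([set u; v] |: E)|.+1.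
Proof.
rewrite comps_setU1 cardsU1 mergeAB (cardsD1 A) mergeA (cardsD1 B (_ :\ A)).
by rewrite mergeB.
Qed.

Lemma card_mergeAB : #|A :|: B| = (#|A| + #|B|)%N.
Proof.
rewrite cardsU; suff -> : A :&: B = set0 by rewrite cards0 subn0.
apply/setP => z; rewrite !inE; apply/negP => /andP[uz vz]; case/negP: nuv.
by apply: (connect_trans uz); rewrite connect_adj_sym.
Qed.

(** The product gets multiplied by [1/a + 1/b], with [a] and [b] the sizes of the merged components;
    denominators are cleared to stay in [nat]. *)
Lemma compsize_prod_setU1 :
  (compsize_prod ([set u; v] |: E) * (#|A| * #|B|) =
   compsize_prod E * (#|A| + #|B|))%N.
Proof.
rewrite /compsize_prod comps_setU1 big_setU1 ?mergeAB //= card_mergeAB.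
rewrite (big_setD1 A mergeA) (big_setD1 B mergeB) /=.
by move: #|A| #|B| (bigop _ _ _) => a b P; ring.
Qed.

End Merge.

Lemma component_set0 x : component set0 x = [set x].
Proof.
apply/setP => y; rewrite in_component inE.
apply/connectP/eqP => [[p]|->]; last by exists [::].
by case: p => [|z p] /=; rewrite /adj ?inE.
Qed.

Lemma comps_set0 : comps set0 = [set [set x] | x : 'I_N].
Proof. by apply: eq_imset => x; apply: component_set0. Qed.

Lemma card_comps_set0 : #|comps set0| = N.
Proof. by rewrite comps_set0 card_imset ?card_ord //; apply: set1_inj. Qed.

Lemma compsize_prod0 : compsize_prod set0 = 1%N.
Proof.
rewrite /compsize_prod comps_set0 big1 // => _ /imsetP[x _ ->].
by rewrite cards1.
Qed.

Lemma card_comps_forest F : forest F -> (#|comps F| + #|F| = N)%N.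
Proof.
move: F; apply: forest_ind => [|F u v fF nuv IH].
  by rewrite card_comps_set0 cards0 addn0.
have := card_comps_setU1 nuv; rewrite cardsU1.
have -> : [set u; v] \notin F.
  by apply: contra nuv => uvF; apply: connect1.
by move: IH => /= + E1; rewrite E1 addSnnS.
Qed.

(* Merging components of sizes a and b multiplies the product by
   1/a + 1/b <= 2. *)
Lemma compsize_prod_le F : forest F -> (compsize_prod F <= 2 ^ #|F|)%N.
Proof.
move: F; apply: forest_ind => [|F u v fF nuv IH].
  by rewrite compsize_prod0 expn_gt0.
rewrite cardsU1.
have -> : [set u; v] \notin F.
  by apply: contra nuv => uvF; apply: connect1.
have := compsize_prod_setU1 nuv; rewrite expnS.
have := card_component_gt0 F u; have := card_component_gt0 F v.
move: (compsize_prod _) => P1 b0 a0 H.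
rewrite -(leq_pmul2r (m := #|component F u| * #|component F v|)) ?muln_gt0 ?a0 //.
rewrite H [(2 * _)%N]mulnC -mulnA; apply: leq_mul => //.
by move: a0 b0; clear; move: #|_| #|_| => a b; nia.
Qed.

(** A component of size [s] receives [1/s] from each of its [s] vertices. *)
Lemma sum_compsize_inv (R : numFieldType) F :
  \sum_x (#|component F x|%:R^-1 : R) = #|comps F|%:R.
Proof.
rewrite (partition_big_imset (component F)) /= -/(comps F).
rewrite -sum1_card natr_sum; apply: eq_bigr => _ /imsetP[x _ ->].
rewrite (eq_bigr (fun=> #|component F x|%:R^-1)) => [|y /eqP-> //].
rewrite sumr_const -[X in _ *+ X = _](_ : #|component F x| = _).
  rewrite -[LHS]mulr_natr mulVf // pnatr_eq0 -lt0n; exact: card_component_gt0.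
by apply: eq_card => y; rewrite in_component -component_eq eq_sym.
Qed.

End Forests.

(** * Counting forests with prescribed components *)

Section UniformComponents.
Variables (N k m : nat).
Hypotheses (m_gt0 : (0 < m)%N) (Nkm : N = (k * m)%N).

Lemma card_comps_uniform (F : {set {set 'I_N}}) :
  (forall x, #|component F x| = m) -> #|comps F| = k.
Proof.
move=> sz; apply/eqP; rewrite -(eqr_nat rat) -sum_compsize_inv.
rewrite (eq_bigr (fun=> m%:R^-1)) => [|x _]; last by rewrite sz.
rewrite sumr_const card_ord -[_ *+ N]mulr_natr.
by rewrite {1}Nkm natrM mulrCA mulVf ?mulr1 ?pnatr_eq0 -?lt0n.
Qed.

Lemma compsize_prod_uniform (F : {set {set 'I_N}}) :
  (forall x, #|component F x| = m) -> compsize_prod F = (m ^ k)%N.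
Proof.
move=> sz; rewrite /compsize_prod (eq_bigr (fun=> m)).
  by rewrite prod_nat_const card_comps_uniform.
by move=> _ /imsetP[x _ ->].
Qed.

End UniformComponents.

Lemma card_pairs_of_edges N (D : {set {set 'I_N}}) : D \subset all_edges N ->
  \sum_(z : 'I_N * 'I_N) ([set z.1; z.2] \in D : nat) = (2 * #|D|)%N.
Proof.
move=> sD; rewrite -big_mkcond /=.
rewrite (partition_big (fun z : 'I_N * 'I_N => [set z.1; z.2]) (mem D)) //=.
rewrite mulnC -sum_nat_const; apply: eq_bigr => e eD.
have : e \in all_edges N by apply: (subsetP sD).
rewrite inE => /cards2P [x [y [nxy defe]]].
rewrite sum1_card.
transitivity #|[set (x, y); (y, x)]|; last first.
  by rewrite cards2 xpair_eqE (negPf nxy).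
apply: eq_card => -[u v]; rewrite !inE /=; apply/andP/orP.
  case=> _ /eqP uve.
  have : u \in e by rewrite -uve !inE eqxx.
  have : v \in e by rewrite -uve !inE eqxx orbT.
  have : x \in [set u; v] by rewrite uve defe !inE eqxx.
  have : y \in [set u; v] by rewrite uve defe !inE eqxx orbT.
  rewrite defe !inE !xpair_eqE => yuv xuv /orP[]/eqP vE /orP[]/eqP uE; subst u v;
    rewrite ?eqxx /=; auto.
    by move: yuv; rewrite orbb eq_sym (negPf nxy).
  by move: xuv; rewrite orbb (negPf nxy).
case=> /eqP[-> ->]; first by rewrite -defe eD.
by rewrite setUC -defe eD.
Qed.

Lemma merge_count_eq (R : fieldType) (X Y P P' a b E : R) :
  X != 0 -> a != 0 -> b != 0 -> P' * (a * b) = P * (a + b) ->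
  E * X = Y * P' -> E = Y * P / X * (a^-1 + b^-1).
Proof.
move=> X0 a0 b0 HP HE; apply: (mulIf X0); rewrite HE.
have -> : P' = P * (a + b) / (a * b) by rewrite -HP mulfK // mulf_neq0.
by field; rewrite X0 a0 b0.
Qed.

(** Cancels the factors common to both sides of the double count: [E] is the number of forests, [D]
    the surplus of components, and [t] the number of orientations of an edge. *)
Lemma double_count_eq (R : fieldType) (X Y P M D t E : R) :
  X != 0 -> M != 0 -> D != 0 -> t != 0 ->
  Y * P / (M * X) * (t * M * D) = t * D * E -> E * X = Y * P.
Proof.
move=> X0 M0 D0 t0 H; apply: (mulfI D0); apply: (mulfI t0).
rewrite !mulrA -H; by field; rewrite X0 M0.
Qed.

(** * Forests whose components are the fibres of a labelling *)

Section Blocks.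
Variables (N k m : nat) (J : eqType) (b : 'I_N -> J).
Hypotheses (m_gt0 : (0 < m)%N) (Nkm : N = (k * m)%N).
Hypothesis sz_b : forall x, #|[set y | b y == b x]| = m.
Implicit Types (F T : {set {set 'I_N}}) (x y u v : 'I_N).

(** Two labellings matter: a constant [b] gives the labelled trees, and a balanced [b] with [k]
    values gives the forests left after splitting a tree. *)
Definition block_forest T : bool :=
  forest T && [forall x, forall y, connect (adj T) x y == (b x == b y)].

Definition block_forests_above F := [set T | block_forest T & F \subset T].

Lemma block_forestP T :
  reflect (forest T /\ forall x y, connect (adj T) x y = (b x == b y))
          (block_forest T).
Proof.
apply: (iffP andP) => -[fT cT]; split=> //.
  by move=> x y; apply/eqP; move/forallP: cT => /(_ x)/forallP/(_ y).
by apply/forallP=> x; apply/forallP=> y; apply/eqP.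
Qed.

Lemma card_component_block_forest T x : block_forest T -> #|component T x| = m.
Proof.
case/block_forestP => _ cT; rewrite -(sz_b x); apply: eq_card => y.
by rewrite in_component cT inE eq_sym.
Qed.

Lemma card_block_forest T : block_forest T -> (k + #|T| = N)%N.
Proof.
move=> bT; have /block_forestP[fT _] := bT.
have := card_comps_forest fT; rewrite (card_comps_uniform m_gt0 Nkm) //.
by move=> x; apply: card_component_block_forest.
Qed.

Section Above.
Variable F : {set {set 'I_N}}.
Hypothesis Fb : forall x y, connect (adj F) x y -> b x = b y.

Lemma component_sub_block x : component F x \subset [set y | b y == b x].
Proof. by apply/subsetP => y; rewrite in_component inE => /Fb ->. Qed.

Lemma card_component_le x : (#|component F x| <= m)%N.
Proof. by rewrite -(sz_b x) subset_leq_card ?component_sub_block. Qed.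

(** When components stay inside blocks, each summand is nonnegative and vanishes exactly if the
    component of [x] fills its block. This yields both the bound [k <= #|comps F|] and its equality
    case. *)
Lemma sum_compsize_inv_excess :
  \sum_x ((#|component F x|%:R : rat)^-1 - m%:R^-1) = #|comps F|%:R - k%:R.
Proof.
rewrite sumrB sum_compsize_inv; congr (_ - _).
rewrite sumr_const card_ord -[_ *+ N]mulr_natr.
by rewrite {1}Nkm natrM mulrCA mulVf ?mulr1 ?pnatr_eq0 -?lt0n.
Qed.

Lemma compsize_inv_excess_ge0 x :
  0 <= (#|component F x|%:R : rat)^-1 - m%:R^-1.
Proof.
rewrite subr_ge0 lef_pV2 ?posrE ?ltr0n ?card_component_gt0 //.
by rewrite ler_nat card_component_le.
Qed.

Lemma card_comps_ge : (k <= #|comps F|)%N.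
Proof.
rewrite -(ler_nat rat) -subr_ge0 -sum_compsize_inv_excess.
by apply: sumr_ge0 => x _; apply: compsize_inv_excess_ge0.
Qed.

Lemma block_forest_of_card : forest F -> #|comps F| = k -> block_forest F.
Proof.
move=> fF cF; apply/block_forestP; split=> // x y.
have /eqP := sum_compsize_inv_excess; rewrite cF subrr psumr_eq0; last first.
  by move=> z _; apply: compsize_inv_excess_ge0.
move/allP/(_ x (mem_index_enum x)) => /=; rewrite subr_eq0.
rewrite (inj_eq invr_inj) eqr_nat => /eqP szx.
have /eqP defC : component F x == [set y | b y == b x].
  by rewrite eqEcard component_sub_block szx sz_b leqnn.
by rewrite -in_component defC inE eq_sym.
Qed.

(** An edge of [T] cannot leave a block, and an edge of [T] outside [F] between vertices connected
    in [F] would close a cycle. *)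
Lemma block_forests_above_setU1 u v :
  forest F ->
  [set T in block_forests_above F | [set u; v] \in T :\: F] =
  if (b u == b v) && ~~ connect (adj F) u v
  then block_forests_above ([set u; v] |: F) else set0.
Proof.
move=> fF; case: ifPn => [/andP[buv nuv]|bad]; apply/setP => T; rewrite !inE.
  rewrite subUset sub1set.
  have -> : [set u; v] \notin F.
    by apply: contra nuv => uvF; apply: connect1.
  by rewrite /= -andbA; congr (_ && _); rewrite andbC.
apply/negP => /andP[/andP[/block_forestP[fT cT] sFT] /andP[uvF uvT]].
case/negP: bad; rewrite -cT connect1 //=.
have /forestP[_ aT] := fT; apply: contra (aT u v uvT); apply: connect_adjS.
by rewrite subsetD1 sFT.
Qed.

(** Counts pairs of a block forest [T] above [F] and an oriented edge of [T :\: F]. Since [T] has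
    [N - k] edges and [F] has [N - #|comps F|], each [T] has [#|comps F| - k] such edges, with two
    orientations each. *)
Lemma double_count_block_forests : forest F ->
  (\sum_(z : 'I_N * 'I_N | (b z.1 == b z.2) && ~~ connect (adj F) z.1 z.2)
     #|block_forests_above ([set z.1; z.2] |: F)| =
   2 * (#|comps F| - k) * #|block_forests_above F|)%N.
Proof.
move=> fF; transitivity (\sum_(T in block_forests_above F)
  \sum_(z : 'I_N * 'I_N) ([set z.1; z.2] \in T :\: F : nat))%N; last first.
  rewrite mulnC -sum_nat_const; apply: eq_bigr => T.
  rewrite inE => /andP[bT sFT]; have /block_forestP[/forestP[sT _] _] := bT.
  rewrite card_pairs_of_edges; last by apply: subset_trans sT; apply: subsetDl.
  congr (_ * _)%N; rewrite cardsD (setIidPr sFT).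
  have := card_block_forest bT; have := card_comps_forest fF; lia.
rewrite exchange_big /= big_mkcond; apply: eq_bigr => -[u v] _ /=.
transitivity #|[set T in block_forests_above F | [set u; v] \in T :\: F]|.
  by rewrite block_forests_above_setU1 //; case: ifP; rewrite ?cards0.
rewrite -sum1_card big_mkcond [RHS]big_mkcond; apply: eq_bigr => T _.
by rewrite !inE; case: (block_forest T && _) => //=; case: (_ && _).
Qed.

(** If the component of [x] has size [c], there are [m - c] partners [y], so [x] contributes
    [(m - c) / c = m (1/c - 1/m)]. Exchanging [x] and [y] accounts for the factor 2. *)
Lemma sum_compsize_inv_pairs :
  \sum_(z : 'I_N * 'I_N | (b z.1 == b z.2) && ~~ connect (adj F) z.1 z.2)
    ((#|component F z.1|%:R : rat)^-1 + #|component F z.2|%:R^-1) =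
  2 * m%:R * (#|comps F|%:R - k%:R).
Proof.
pose G (z : 'I_N * 'I_N) := (b z.1 == b z.2) && ~~ connect (adj F) z.1 z.2.
have swap : \sum_(z | G z) (#|component F z.2|%:R : rat)^-1 =
            \sum_(z | G z) (#|component F z.1|%:R : rat)^-1.
  rewrite (reindex_inj (inv_inj (@swap_pairK _ _))) /=.
  by apply: eq_bigl => -[u v]; rewrite /G /= eq_sym connect_adj_sym.
rewrite big_split /= swap -mulr2n -[_ *+ 2]mulr_natl -[2 * m%:R * _]mulrA.
congr (_ * _).
transitivity (\sum_x m%:R * ((#|component F x|%:R : rat)^-1 - m%:R^-1)).
  rewrite -(pair_big_dep xpredT (fun x y => (b x == b y) && ~~ connect (adj F) x y)
    (fun x _ => (#|component F x|%:R : rat)^-1)) /=.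
  apply: eq_bigr => x _; rewrite sumr_const.
  rewrite (_ : #|_| = (m - #|component F x|)%N); last first.
    rewrite -{1}(sz_b x) -[in X in (_ - X)%N](setIidPr (component_sub_block x)).
    rewrite -cardsD; apply: eq_card => y.
    by rewrite !inE andbC [b y == _]eq_sym.
  rewrite -[_ *+ (_ - _)]mulr_natl natrB ?card_component_le // mulrBl mulrBr.
  by rewrite !mulfV // pnatr_eq0 -lt0n ?card_component_gt0.
by rewrite -mulr_sumr sum_compsize_inv_excess.
Qed.

End Above.

(* Both sides satisfy the same recursion in [F]: a block forest above [F] can
   be reached by first adding any one of its edges outside [F]. *)
Lemma card_block_forests_above F : forest F ->
  (forall x y, connect (adj F) x y -> b x = b y) ->
  (#|block_forests_above F| * m ^ (2 * k + #|F|) = m ^ N * compsize_prod F)%N.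
Proof.
have [d] := ubnP (#|comps F| - k); elim: d F => // d IHd F ltd fF Fb.
have kleF := card_comps_ge Fb; have cF := card_comps_forest fF.
(* With no surplus of components, [F] is itself a block forest and the only one above [F]. *)
have [eqk|ltk] := leqP #|comps F| k.
  have eF : #|comps F| = k by apply/eqP; rewrite eqn_leq eqk.
  have bF := block_forest_of_card Fb fF eF.
  rewrite (compsize_prod_uniform m_gt0 Nkm); last first.
    by move=> x; apply: card_component_block_forest.
  have -> : block_forests_above F = [set F].
    apply/setP => T; rewrite !inE; apply/andP/eqP => [[bT sFT]|->] //.
    apply/eqP; rewrite eq_sym eqEcard sFT /=.
    by have := card_block_forest bT; rewrite -[RHS](card_block_forest bF) => /addnI->.
  by rewrite cards1 mul1n -expnD; congr (_ ^ _)%N; lia.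
have m0 : (m%:R : rat) != 0 by rewrite pnatr_eq0 -lt0n.
have := congr1 (fun i => i%:R : rat) (double_count_block_forests fF).
rewrite natr_sum (eq_bigr (fun z : 'I_N * 'I_N => m%:R ^+ N * (compsize_prod F)%:R
   / m%:R ^+ (2 * k + #|F|).+1 *
   ((#|component F z.1|%:R : rat)^-1 + #|component F z.2|%:R^-1))); last first.
  case=> u v /= /andP[/eqP buv nuv].
  have nuvF : [set u; v] \notin F.
    by apply: contra nuv => uvF; apply: connect1.
  have ltd' : (#|comps ([set u; v] |: F)| - k < d)%N.
    have := card_comps_setU1 nuv; lia.
  have Fb' x y : connect (adj ([set u; v] |: F)) x y -> b x = b y.
    rewrite connect_setU1 => /or3P[/Fb //|/andP[]|/andP[]].
      by move=> /Fb -> /Fb <-.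
    by move=> /Fb -> /Fb <-.
  have := IHd _ ltd' (forest_setU1 fF nuv) Fb'; rewrite cardsU1 nuvF.
  have := compsize_prod_setU1 nuv.
  have := card_component_gt0 F u; have := card_component_gt0 F v.
  move: #|component F u| #|component F v| (compsize_prod (_ |: _)) => p q P'.
  move=> q0 p0 /(congr1 (fun i => i%:R : rat)); rewrite !natrM natrD => HP.
  move=> /(congr1 (fun i => i%:R : rat)); rewrite !natrM !natrX => HE.
  have p1 : (p%:R : rat) != 0 by rewrite pnatr_eq0 -lt0n.
  have q1 : (q%:R : rat) != 0 by rewrite pnatr_eq0 -lt0n.
  have X0 : (m%:R : rat) ^+ (2 * k + #|F|).+1 != 0 by rewrite expf_neq0.
  by apply: (merge_count_eq X0 p1 q1 HP); rewrite -HE addnS.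
rewrite -mulr_sumr (sum_compsize_inv_pairs Fb) !natrM natrB // => H.
have d0 : (#|comps F|%:R - k%:R : rat) != 0.
  by rewrite subr_eq0 eqr_nat neq_ltn ltk orbT.
apply/eqP; rewrite -(eqr_nat rat) !natrM !natrX; apply/eqP.
have X0 : (m%:R : rat) ^+ (2 * k + #|F|) != 0 by rewrite expf_neq0.
move: H; rewrite exprS; apply: double_count_eq => //.
Qed.

End Blocks.

(** * Splittable trees *)

(** A closed set is a union of components, all of size [n]. *)
Lemma dvdn_card_closed N (F : {set {set 'I_N}}) (X : {set 'I_N}) n :
  (forall x, #|component F x| = n) ->
  (forall x y, adj F x y -> x \in X -> y \in X) -> (n %| #|X|)%N.
Proof.
move=> szF clX.
have sub x : x \in X -> component F x \subset X.
  move=> xX; apply/subsetP => y; rewrite in_component => cxy.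
  by rewrite -(closed_connect (intro_closed (connect_adj_sym F) clX) cxy).
rewrite -sum1_card (partition_big_imset (component F)) /=.
apply: dvdn_sum => _ /imsetP[x xX ->]; rewrite sum1_card.
rewrite (_ : #|_| = #|component F x|); first by rewrite szF.
apply: eq_card => y.
rewrite [LHS]inE component_eq connect_adj_sym -in_component andbC.
by case: (boolP (y \in component F x)) => // /(subsetP (sub _ xX)).
Qed.

(* An edge uv of T lies outside F iff both sides of T - uv are unions of
   components of F, so F can be read off T. *)
Lemma uniform_subforest_edge N (T F : {set {set 'I_N}}) n u v :
  forest T -> F \subset T -> (forall x, #|component F x| = n) ->
  [set u; v] \in T ->
  ([set u; v] \in F) = ~~ (n %| #|component (T :\ [set u; v]) u|)%N.
Proof.
move=> fT sFT szF uvT; set X := component _ _.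
have /forestP[_ /(_ u v uvT) nuv] := fT.
have closedX x y : [set x; y] \in T -> [set x; y] != [set u; v] ->
    x \in X -> y \in X.
  rewrite !in_component => xyT ne ux; apply: (connect_trans ux).
  by apply: connect1; rewrite /adj !inE ne.
case: (boolP (_ \in F)) => [uvF|uvF].
  (* Only [uv] leaves [X], so [X :|: C] is closed under [F]. Then [n] divides [#|C :\: X|], which
     lies strictly between 0 and [n]: [v] is in this difference and [u] is not. *)
  apply/esym/negP => dvdX; pose C := component F u.
  have uvC : v \in C by rewrite in_component connect1.
  have dvdXC : (n %| #|X :|: C|)%N.
    apply: (dvdn_card_closed szF) => x y xyF.
    case: (eqVneq [set x; y] [set u; v]) => [xyuv|ne].
      have : y \in [set u; v] by rewrite -xyuv !inE eqxx orbT.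
      rewrite in_set2 => /orP[]/eqP-> _; rewrite in_setU; last by rewrite uvC orbT.
      by rewrite component_refl.
    rewrite !in_setU => /orP[xX|xC].
      by rewrite (closedX x y) // (subsetP sFT).
    by move: xC; rewrite !in_component => /connect_trans ->; rewrite ?orbT ?connect1.
  have : (n %| #|C :\: X|)%N.
    move: dvdXC; rewrite -(cardsID X (X :|: C)) setUK setDUl setDv set0U.
    by rewrite dvdn_addr.
  apply/negP; rewrite gtnNdvd //.
    by apply/card_gt0P; exists v; rewrite inE uvC in_component nuv.
  rewrite -(szF u); apply: proper_card; apply/properP; split; first exact: subsetDl.
  by exists u; rewrite ?component_refl // inE component_refl.
rewrite (dvdn_card_closed szF) // => x y xyF; apply: closedX.
  exact: (subsetP sFT).
by apply: contraNneq uvF => <-.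
Qed.

Lemma uniform_subforest_uniq N (T F F' : {set {set 'I_N}}) n :
  forest T -> F \subset T -> F' \subset T ->
  (forall x, #|component F x| = n) -> (forall x, #|component F' x| = n) ->
  F = F'.
Proof.
move=> fT sF sF' szF szF'; apply/setP => e.
have [eT|eT] := boolP (e \in T); last first.
  by rewrite (contraNF (subsetP sF e) eT) (contraNF (subsetP sF' e) eT).
have : #|e| == 2%N by rewrite (forest_edge_size fT eT).
case/cards2P => u [v [_ defe]]; rewrite defe in eT *.
by rewrite (uniform_subforest_edge fT sF szF) // (uniform_subforest_edge fT sF' szF').
Qed.

(** * Multinomial count of labellings *)

Section Multinomial.
Variable k : nat.

Definition tuples_with_counts N (s : 'I_k -> nat) : {set N.-tuple 'I_k} :=
  [set t : N.-tuple 'I_k | [forall j, count_mem j t == s j]].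

(** Induction on the length: the tuples with first letter [j] account for the summand [s j] when the
    leading factor of the factorial is written as [\sum_j s j]. *)
Lemma card_tuples_with_counts N (s : 'I_k -> nat) : (\sum_j s j = N)%N ->
  (#|tuples_with_counts N s| * \prod_j (s j)`! = N`!)%N.
Proof.
elim: N s => [|N IH] s sumN.
  have s0 j : s j = 0%N.
    by apply/eqP; move/eqP: sumN; rewrite sum_nat_eq0 => /forallP/(_ j).
  rewrite big1 => [|j _]; last by rewrite s0.
  rewrite muln1 (_ : tuples_with_counts 0 s = [set [tuple]]) ?cards1 //.
  apply/setP => t; rewrite !inE (tuple0 t) eqxx.
  by apply/forallP => j; rewrite s0.
rewrite factS -[X in (X * N`!)%N]sumN [RHS]big_distrl /= -sum1_card big_distrl /=.
rewrite (partition_big (fun t : N.+1.-tuple 'I_k => thead t) xpredT) //=.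
apply: eq_bigr => j _; rewrite -big_distrl /= sum1_card.
pose s' i := if i == j then (s j).-1 else s i.
case sj: (s j) => [|n].
  rewrite mul0n (_ : #|_| = 0%N) ?mul0n //; apply: eq_card0 => t.
  apply: negbTE; apply/negP => /andP[]; rewrite inE => /forallP/(_ j)/eqP + /eqP tj.
  by rewrite sj (tuple_eta t) tj /= eqxx.
have sum' : (\sum_i s' i = N)%N.
  apply: succn_inj; rewrite -sumN (bigD1 j) //= [in RHS](bigD1 j) //= /s' eqxx sj.
  by rewrite addSn; congr (_ + _).+1; apply: eq_bigr => i /negPf->.
rewrite -(IH s' sum') (bigD1 j) //= sj factS.
rewrite [in RHS](bigD1 j) //= {2}/s' eqxx sj /=.
rewrite (eq_bigr (fun i => (s' i)`!)); last by move=> i /negPf ne; rewrite /s' ne.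
rewrite (_ : #|_| = #|tuples_with_counts N s'|); first by ring.
rewrite -(card_imset (tuples_with_counts N s') (f := fun t : N.-tuple 'I_k => [tuple of j :: t])).
  apply: eq_card => t; apply/andP/imsetP.
    case; rewrite inE => /forallP ct /eqP tj; exists [tuple of behead t].
      rewrite inE; apply/forallP => i; have := ct i.
      rewrite {1}(tuple_eta t) tj /= /s' [i == j]eq_sym.
      by case: (eqVneq j i) => [<-|ne] /=; rewrite ?sj ?add1n ?add0n.
    by rewrite {1}(tuple_eta t) tj; apply: val_inj.
  case=> t'; rewrite inE => /forallP ct ->; rewrite theadE eqxx inE; split=> //.
  apply/forallP => i; have := ct i; rewrite /= /s' [i == j]eq_sym.
  by case: (eqVneq j i) => [<-|ne] /=; rewrite ?sj ?add1n ?add0n.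
by move=> t t' /(congr1 val) [] /val_inj.
Qed.

Lemma card_tnth_fiber N (t : N.-tuple 'I_k) j :
  #|[set i | tnth t i == j]| = count_mem j t.
Proof. by rewrite -sum1_count big_tuple -sum1_card; apply: eq_bigl => i; rewrite inE. Qed.

End Multinomial.

(** * Labelled trees and the trees containing a given forest *)

Section Trees.
Variable N : nat.
Implicit Types (F T G : {set {set 'I_N}}).

Definition trees : {set {set {set 'I_N}}} := [set T | block_forest (fun=> tt) T].

Lemma spanning_treeP G T : G \subset all_edges N ->
  spanning_tree G T <-> T \in trees /\ T \subset G.
Proof.
move=> sG; split.
  move=> [sT [cT aT]]; split=> //; rewrite inE; apply/block_forestP; split.
    by apply/forestP; split=> //; apply: subset_trans sG.
  by move=> x y; rewrite cT.
rewrite inE => -[/block_forestP[/forestP[_ aT] cT] sT].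
by split=> //; split=> // x y; rewrite cT.
Qed.

Lemma tauE G : G \subset all_edges N -> tau G = #|[set T in trees | T \subset G]|.
Proof.
move=> sG; apply: eq_card => T; rewrite inE [RHS]inE.
by apply/asboolP/andP => [/(spanning_treeP _ sG)|/(spanning_treeP _ sG)].
Qed.

Definition split_trees k : {set {set {set 'I_N}}} :=
  [set T in trees | `[< k_splittable k T >]].

Lemma tau_kE k G : G \subset all_edges N ->
  tau_k k G = #|[set T in split_trees k | T \subset G]|.
Proof.
move=> sG; apply: eq_card => T; rewrite inE [RHS]inE [_ \in split_trees k]inE.
apply/asboolP/idP => [[/(spanning_treeP _ sG)[-> ->] sp]|].
  by rewrite andbT; apply/asboolP.
move=> /andP[/andP[tT /asboolP sp] sT]; split=> //.
by apply/(spanning_treeP _ sG).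
Qed.

Hypothesis N_gt0 : (0 < N)%N.

Lemma card_block_const (x : 'I_N) :
  #|[set y : 'I_N | (fun=> tt) y == (fun=> tt) x]| = N.
Proof. by rewrite -[RHS]card_ord -cardsT; apply: eq_card => y; rewrite !inE. Qed.

Lemma card_tree T : T \in trees -> (#|T|.+1 = N)%N.
Proof.
rewrite inE => bT; rewrite -add1n.
by rewrite (card_block_forest (m := N) N_gt0 _ card_block_const bT) ?mul1n.
Qed.

(** The case of a single block. With [c = N - #|F|] components the count is [N^(c-2)] times the
    product of their sizes; the exponent is negative when [c = 1], so powers of [N] stand on both
    sides. *)
Lemma card_trees_above F : forest F ->
  (#|[set T in trees | F \subset T]| * N ^ (#|F|.+2) = N ^ N * compsize_prod F)%N.
Proof.
move=> fF; have := card_block_forests_above (k := 1) N_gt0 (esym (mul1n N)) card_block_const fF.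
move=> <- //; congr (_ * _)%N; apply: eq_card => T.
by rewrite !inE.
Qed.

(** Cayley's formula, from the empty forest. *)
Lemma card_trees : (#|trees| * N ^ 2 = N ^ N)%N.
Proof.
have := card_trees_above (forest0 N); rewrite cards0 compsize_prod0 muln1 => <-.
by congr (_ * _)%N; apply: eq_card => T; rewrite [RHS]inE sub0set andbT.
Qed.

End Trees.

(** * Lower bound for the number of splittable trees *)

Section SplitTrees.
Variables (k n : nat).
Hypotheses (k_gt0 : (0 < k)%N) (n_gt0 : (0 < n)%N).
Let N := (k * n)%N.
Let N_gt0 : (0 < N)%N. Proof. by rewrite muln_gt0 k_gt0. Qed.
Implicit Types (F T : {set {set 'I_N}}) (t : N.-tuple 'I_k).

Definition labellings : {set N.-tuple 'I_k} := tuples_with_counts N (fun=> n).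

Lemma card_labelling_fiber t x :
  t \in labellings -> #|[set y | tnth t y == tnth t x]| = n.
Proof. by rewrite inE => /forallP/(_ (tnth t x))/eqP; rewrite card_tnth_fiber. Qed.

Lemma card_labellings : (#|labellings| * n`! ^ k = (k * n)`!)%N.
Proof.
have := @card_tuples_with_counts k N (fun=> n).
by rewrite sum_nat_const prod_nat_const card_ord; apply.
Qed.

Lemma uniform_subforest_splittable T F :
  T \in trees N -> F \subset T -> (forall x, #|component F x| = n) ->
  T \in split_trees N k.
Proof.
move=> tT sFT szF; rewrite inE tT /=; apply/asboolP; exists (T :\: F).
have TDD : T :\: (T :\: F) = F by rewrite setDDr setDv set0U (setIidPr sFT).
split; rewrite ?subsetDl //; last by move=> x y; rewrite TDD !szF.
have fF : forest F.
  by apply: (forest_sub sFT); move: tT; rewrite inE => /block_forestP[].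
have := card_comps_forest fF; rewrite (card_comps_uniform n_gt0 erefl szF).
rewrite cardsDS //; have := card_tree N_gt0 tT.
by move: #|T| #|F| => a b; move: N k_gt0; clear => M; lia.
Qed.

Definition split_data T : {set N.-tuple 'I_k * {set {set 'I_N}}} :=
  [set q | [&& q.1 \in labellings, block_forest (tnth q.1) q.2 & q.2 \subset T]].

(** The forest is determined by [T], and two labellings with the same fibres differ by a map of the
    labels. The crude count [k ^ k] of these maps later cancels the same factor in the number of
    trees above a block forest. *)
Lemma card_split_data_le T : forest T -> (#|split_data T| <= k ^ k)%N.
Proof.
move=> fT; have [->|[[t0 F0]]] := set_0Vmem (split_data T); first by rewrite cards0.
rewrite inE /= => /and3P[lt0 bF0 sF0].
have szF0 x := card_component_block_forest (fun y => card_labelling_fiber y lt0) x bF0.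
have /block_forestP[_ cF0] := bF0.
pose f (g : {ffun 'I_k -> 'I_k}) := ([tuple g (tnth t0 i) | i < N], F0).
rewrite -[X in (X ^ _)%N]card_ord -[X in (_ ^ X)%N]card_ord -card_ffun.
apply: leq_trans (leq_imset_card f _); apply: subset_leq_card.
apply/subsetP => -[t F]; rewrite inE /= => /and3P[lt bF sF].
have szF x := card_component_block_forest (fun y => card_labelling_fiber y lt) x bF.
have EF := uniform_subforest_uniq fT sF sF0 szF szF0; subst F.
have /block_forestP[_ cF] := bF.
(* The label [j] goes to the new label of any vertex that [t0] labels [j]; the value [j] in the
   other branch is a default. *)
apply/imsetP; exists [ffun j => if [pick x | tnth t0 x == j] is Some x
                               then tnth t x else j] => //.
congr (_, _); apply: eq_from_tnth => x; rewrite tnth_mktuple ffunE.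
case: pickP => [y|/(_ x)]; last by rewrite eqxx.
by rewrite -cF0 cF => /eqP.
Qed.

(** Counts triples of a balanced labelling, a block forest for it and a tree above that forest. Such
    a tree is splittable and occurs at most [k ^ k] times, while each labelling has [n^(N-2k)]
    forests, each below [k^k n^(2k) / N^2] trees. *)
Lemma card_split_trees_ge :
  (#|labellings| * n ^ N <= #|split_trees N k| * N ^ 2)%N.
Proof.
have main : (\sum_(t in labellings) \sum_(F | block_forest (tnth t) F)
    #|[set T in trees N | F \subset T]| <= #|split_trees N k| * k ^ k)%N.
  rewrite -sum_nat_const.
  apply: leq_trans (_ : \sum_(T in split_trees N k) #|split_data T| <= _)%N; last first.
    apply: leq_sum => T; rewrite inE => /andP[]; rewrite inE.
    by move=> /block_forestP[fT _] _; apply: card_split_data_le.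
  rewrite pair_big_dep /=.
  under eq_bigr do rewrite -sum1_card.
  under [X in (_ <= X)%N]eq_bigr do rewrite -sum1_card.
  rewrite (exchange_big_dep (mem (split_trees N k))) /=.
    apply: leq_sum => T spT; rewrite leq_eqVlt; apply/orP; left; apply/eqP.
    apply: eq_bigl => -[t F] /=; rewrite !inE /=.
    have -> : block_forest (fun=> tt) T by move: spT; rewrite !inE => /andP[].
    by rewrite -andbA.
  move=> [t F] T /= /andP[lt bF]; rewrite inE => /andP[tT sFT].
  apply: uniform_subforest_splittable tT sFT _ => x.
  exact: (card_component_block_forest (fun y => card_labelling_fiber y lt) x bF).
have above t F : t \in labellings -> block_forest (tnth t) F ->
  (#|[set T in trees N | F \subset T]| * N ^ 2 = k ^ k * n ^ (2 * k))%N.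
  move=> lt bF; have /block_forestP[fF _] := bF.
  have szF x := card_component_block_forest (fun y => card_labelling_fiber y lt) x bF.
  have := card_trees_above N_gt0 fF.
  rewrite (compsize_prod_uniform n_gt0 erefl szF).
  have cF := card_block_forest n_gt0 erefl (fun y => card_labelling_fiber y lt) bF.
  have -> : (N ^ N = N ^ k * N ^ #|F|)%N by rewrite -expnD cF.
  rewrite -addn2 expnD => E; apply/eqP.
  rewrite -(eqn_pmul2r (m := N ^ #|F|)) ?expn_gt0 ?N_gt0 //; apply/eqP.
  rewrite -mulnA [(N ^ 2 * _)%N]mulnC E expnMn mul2n -addnn expnD.
  by rewrite !mulnA [LHS]mulnAC.
have tot : ((\sum_(t in labellings) \sum_(F | block_forest (tnth t) F)
    #|[set T in trees N | F \subset T]|) * N ^ 2 = #|labellings| * n ^ N * k ^ k)%N.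
  rewrite big_distrl /= -mulnA -sum_nat_const; apply: eq_bigr => t lt.
  rewrite big_distrl /= (eq_bigr (fun=> k ^ k * n ^ (2 * k))%N); last first.
    by move=> F bF; apply: above lt bF.
  rewrite sum_nat_const mulnCA [(k ^ k * _)%N]mulnC; congr (_ * _)%N.
  have := card_block_forests_above n_gt0 erefl
    (fun y => card_labelling_fiber y lt) (forest0 N).
  rewrite cards0 addn0 compsize_prod0 muln1 => <- //.
    by congr (_ * _)%N; apply: eq_card => F; rewrite !inE sub0set andbT.
  by move=> x y; rewrite -in_component component_set0 inE => /eqP ->.
rewrite -(leq_pmul2r (m := k ^ k)) ?expn_gt0 ?k_gt0 // -tot mulnAC.
by rewrite leq_mul2r main orbT.
Qed.
End SplitTrees.

(** * Random graphs *)

Lemma sum_subset_weight (R : comNzRingType) (I : finType) (A D : {set I}) (p : R) :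
  D \subset A ->
  \sum_(G : {set I} | (D \subset G) && (G \subset A))
    p ^+ #|G| * (1 - p) ^+ (#|A| - #|G|) = p ^+ #|D|.
Proof.
move=> sDA.
(* [f i] and [g i] are the weights of [i] being in or out of [G]: elements of [D] are forced in and
   those outside [A] are forced out. *)
pose f i := if i \in A then p else 0.
pose g i := if i \in D then 0 else if i \in A then 1 - p else 1.
transitivity (\prod_i (f i + g i)); last first.
  rewrite -prodr_const [RHS]big_mkcond; apply: eq_bigr => i _; rewrite /f /g.
  have [/(subsetP sDA)->|_] := boolP (i \in D); first by rewrite addr0.
  by case: ifP => _; rewrite ?add0r // addrC subrK.
rewrite bigA_distr big_mkcond; apply: eq_bigr => G _.
case: ifPn => [/andP[sDG sGA]|].
  rewrite (bigID (mem G)) /=; congr (_ * _).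
    rewrite -prodr_const; apply: eq_bigr => i iG.
    by rewrite iG /f (subsetP sGA).
  rewrite -cardsDS // -prodr_const; transitivity (\prod_(i | i \notin G) g i);
    last by apply: eq_bigr => i /negPf ->.
  rewrite big_mkcond [RHS]big_mkcond; apply: eq_bigr => i _; rewrite !inE /g.
  have [iG //|iG] := boolP (i \in G).
  by rewrite (contraNF (subsetP sDG i) iG).
rewrite negb_and => /orP[/subsetPn[i iD iG]|/subsetPn[i iG iA]].
  by rewrite (bigD1 i) //= (negPf iG) /g iD mul0r.
by rewrite (bigD1 i) //= iG /f (negPf iA) mul0r.
Qed.

Lemma sum_subset_expr (R : comNzRingType) (I : finType) (S : {set I}) (y : R) :
  \sum_(F : {set I} | F \subset S) y ^+ #|F| = (1 + y) ^+ #|S|.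
Proof.
rewrite -prodr_const [RHS]big_mkcond /=.
transitivity (\prod_i ((if i \in S then y else 0) + 1)); last first.
  by apply: eq_bigr => i _; case: ifP; rewrite ?add0r // addrC.
rewrite bigA_distr big_mkcond; apply: eq_bigr => F _; case: ifPn => [sFS|].
  rewrite -prodr_const big_mkcond; apply: eq_bigr => i _.
  by case: ifP => // /(subsetP sFS) ->.
by move=> /subsetPn[i iF iS]; rewrite (bigD1 i) //= iF (negPf iS) mul0r.
Qed.

(** Jensen's inequality for [1/t], through the tangent bound [1/t >= 2 a - a^2 t], whose defect is
    [(1 - a t)^2 / t]. The choice [a = S / B] gives the best constant. *)
Lemma sum_div_ge (R : realFieldType) (I : finType) (P : pred I) (w t : I -> R) B :
  (forall i, P i -> 0 <= w i) -> (forall i, P i -> 0 < t i) -> 0 < B ->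
  \sum_(i | P i) w i * t i <= B ->
  (\sum_(i | P i) w i) ^+ 2 / B <= \sum_(i | P i) w i / t i.
Proof.
move=> w0 t0 B0 leB; set S := \sum_(i | P i) w i; pose a := S / B.
apply: le_trans (_ : \sum_(i | P i) w i * (2 * a - a ^+ 2 * t i) <= _).
  under eq_bigr => i _ do rewrite mulrBr [w i * (a ^+ 2 * _)]mulrCA.
  rewrite sumrB -mulr_suml -mulr_sumr -/S.
  have -> : S ^+ 2 / B = S * (2 * a) - a ^+ 2 * B.
    by rewrite /a; field; rewrite gt_eqF.
  by rewrite lerD2l lerN2 ler_wpM2l // sqr_ge0.
apply: ler_sum => i Pi; apply: ler_wpM2l; first exact: w0.
rewrite -subr_ge0.
have -> : (t i)^-1 - (2 * a - a ^+ 2 * t i) = (1 - a * t i) ^+ 2 / t i.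
  by field; rewrite gt_eqF ?t0.
by rewrite divr_ge0 ?sqr_ge0 // ltW ?t0.
Qed.

(** * Moment bounds for the number of spanning trees *)

Section Probability.
Variables (R : realType) (N : nat).
Hypothesis N_gt0 : (0 < N)%N.
Implicit Types (F T G : {set {set 'I_N}}).

Lemma N_neq0 : (N%:R : R) != 0.
Proof. by rewrite pnatr_eq0 -lt0n. Qed.

Lemma card_trees_gt0 : (0 < #|trees N|)%N.
Proof.
have := card_trees N_gt0; case: #|trees N| => //; rewrite mul0n => /esym/eqP.
by rewrite expn_eq0 -[(N == 0)%N]negbK -lt0n N_gt0.
Qed.

Lemma tree_edges T : T \in trees N -> T \subset all_edges N.
Proof. by rewrite inE => /block_forestP[/forestP[]]. Qed.

Lemma card_trees_above_le F : forest F ->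
  (#|[set T in trees N | F \subset T]|%:R : R) <= #|trees N|%:R * (2 / N%:R) ^+ #|F|.
Proof.
move=> fF; rewrite expr_div_n mulrA ler_pdivlMr ?exprn_gt0 ?ltr0n //.
rewrite -!natrX -!natrM ler_nat -(leq_pmul2r (m := N ^ 2)) ?expn_gt0 ?N_gt0 //.
rewrite -mulnA -expnD addn2 (card_trees_above N_gt0 fF) mulnAC (card_trees N_gt0).
by rewrite leq_mul2l compsize_prod_le ?orbT.
Qed.

(* The intersection of a fixed tree with a uniform random tree has a
   generating function dominated by that of a Poisson variable of mean 2. *)
Lemma sum_trees_expr_card_le T (y : R) : T \in trees N -> 0 <= y ->
  \sum_(T' in trees N) (1 + y) ^+ #|T :&: T'| <= #|trees N|%:R * expR (2 * y).
Proof.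
move=> tT y0.
(* Each power is expanded over the subsets [F] of [T :&: T'], and the sums are exchanged. *)
have -> : \sum_(T' in trees N) (1 + y) ^+ #|T :&: T'| =
  \sum_(F : {set {set 'I_N}} | F \subset T) y ^+ #|F| * #|[set T' in trees N | F \subset T']|%:R.
  under eq_bigr do rewrite -sum_subset_expr.
  rewrite (exchange_big_dep (fun F : {set {set 'I_N}} => F \subset T)) /=; last first.
    by move=> T' F _; rewrite subsetI => /andP[].
  apply: eq_bigr => F sFT; rewrite sumr_const -[in LHS]mulr_natr.
  congr (_ * _%:R); apply: eq_card => T'.
  by rewrite [RHS]inE [LHS]unfold_in subsetI sFT.
apply: le_trans (_ : \sum_(F : {set {set 'I_N}} | F \subset T)
  #|trees N|%:R * (2 * y / N%:R) ^+ #|F| <= _).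
  apply: ler_sum => F sFT; rewrite [2 * y]mulrC -mulrA exprMn mulrCA.
  apply: ler_wpM2l; first exact: exprn_ge0.
  apply: card_trees_above_le; apply: (forest_sub sFT).
  by move: tT; rewrite inE => /block_forestP[].
rewrite -mulr_sumr sum_subset_expr; apply: ler_wpM2l; first exact: ler0n.
have yN0 : 0 <= 2 * y / N%:R by rewrite divr_ge0 ?mulr_ge0 ?ler0n.
(* Uses [1 + z <= expR z], then [#|T| <= N]. *)
apply: le_trans (_ : expR (2 * y / N%:R) ^+ #|T| <= _).
  by apply: lerXn2r; rewrite ?nnegrE ?expR_ge0 ?expR_ge1Dx // addr_ge0.
rewrite -expRM_natl ler_expR -{2}[2 * y](mulfVK N_neq0) mulrC.
apply: ler_wpM2l => //; rewrite ler_nat.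
by rewrite (leq_trans (leqnSn _)) // (card_tree N_gt0 tT).
Qed.

Variable p : R.
Hypotheses (p_gt0 : 0 < p) (p_le1 : p <= 1).

Lemma gnp_weight_ge0 G : 0 <= gnp_weight p G.
Proof. by rewrite mulr_ge0 ?exprn_ge0 ?subr_ge0 // ltW. Qed.

Lemma sum_gnp_weight_above F : F \subset all_edges N ->
  \sum_(G in graphs N | F \subset G) gnp_weight p G = p ^+ #|F|.
Proof.
move=> sF; rewrite -(sum_subset_weight p sF); apply: eq_bigl => G.
by rewrite inE andbC.
Qed.

(** Both [T] and [T'] lie in [G] with probability [p ^+ #|T :|: T'|], which is [p ^+ (2 * #|T|)]
    times the power [#|T :&: T'|] of [1/p = 1 + y], where [y = p^-1 - 1]. *)
Lemma sum_gnp_weight_tau_le T : T \in trees N ->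
  \sum_(G in graphs N | T \subset G) gnp_weight p G * (tau G)%:R <=
  p ^+ (2 * #|T|) * (#|trees N|%:R * expR (2 * (p^-1 - 1))).
Proof.
move=> tT.
have y0 : 0 <= p^-1 - 1 by rewrite subr_ge0 invf_ge1.
apply: le_trans (ler_wpM2l _ (sum_trees_expr_card_le tT y0)); last first.
  by rewrite exprn_ge0 // ltW.
rewrite mulr_sumr.
have -> : \sum_(G in graphs N | T \subset G) gnp_weight p G * (tau G)%:R =
  \sum_(T' in trees N) \sum_(G in graphs N | T :|: T' \subset G) gnp_weight p G.
  rewrite (exchange_big_dep
    (fun G : {set {set 'I_N}} => (G \in graphs N) && (T \subset G))) /=; last first.
    by move=> T' G _; rewrite subUset => /and3P[-> -> _].
  apply: eq_bigr => G /andP[Gg sTG]; have sG : G \subset all_edges N by rewrite inE in Gg.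
  rewrite sumr_const -[in RHS]mulr_natr (tauE sG); congr (_ * _%:R).
  by apply: eq_card => T'; rewrite [LHS]inE [RHS]unfold_in subUset Gg sTG.
apply: ler_sum => T' tT'.
rewrite sum_gnp_weight_above ?subUset ?tree_edges //.
have -> : (2 * #|T| = #|T :|: T'| + #|T :&: T'|)%N.
  rewrite cardsUI mul2n -addnn; congr (_ + _)%N; apply: succn_inj.
  by rewrite !card_tree.
rewrite exprD -mulrA -exprMn addrC subrK mulfV ?expr1n ?mulr1 //.
by rewrite gt_eqF.
Qed.

Lemma tau_gt0 G T : G \in graphs N -> T \in trees N -> T \subset G -> (0 < tau G)%N.
Proof.
rewrite inE => sG tT sT; rewrite (tauE sG); apply/card_gt0P; exists T.
by rewrite inE tT.
Qed.

(** Jensen over the graphs containing [T]: their total weight is [p ^+ #|T|], whose square cancels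
    the power of [p] in the bound for the mean of [tau]. *)
Lemma sum_gnp_weight_div_tau_ge T : T \in trees N ->
  (#|trees N|%:R * expR (2 * (p^-1 - 1)))^-1 <=
  \sum_(G in graphs N | T \subset G) gnp_weight p G / (tau G)%:R.
Proof.
move=> tT; have pT : 0 < p ^+ (2 * #|T|) by rewrite exprn_gt0.
have B0 : 0 < #|trees N|%:R * expR (2 * (p^-1 - 1)).
  by rewrite mulr_gt0 ?expR_gt0 ?ltr0n ?card_trees_gt0.
apply: le_trans (sum_div_ge _ _ (mulr_gt0 pT B0) (sum_gnp_weight_tau_le tT)).
- rewrite sum_gnp_weight_above ?tree_edges // -exprM mulnC.
  rewrite [X in _ <= _ * X]invfM mulrA mulfV ?mul1r //.
  by rewrite gt_eqF.
- by move=> G _; apply: gnp_weight_ge0.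
- by move=> G /andP[Gg sTG]; rewrite ltr0n (tau_gt0 Gg tT sTG).
Qed.

Lemma connected_graph_above G T :
  G \in graphs N -> T \in trees N -> T \subset G -> G \in connected_graphs N.
Proof.
move=> Gg tT sTG; rewrite inE Gg /=; apply/asboolP => x y.
apply: (connect_adjS sTG); move: tT; rewrite inE => /block_forestP[_ ->].
by rewrite eqxx.
Qed.

Lemma sum_connected_gnp_weight_le1 :
  \sum_(G in connected_graphs N) gnp_weight p G <= 1.
Proof.
have := sum_gnp_weight_above (sub0set (all_edges N)); rewrite cards0 expr0 => <-.
rewrite [leLHS]big_mkcond [leRHS]big_mkcond; apply: ler_sum => G _.
rewrite sub0set andbT [G \in connected_graphs N]inE; case: ifP => [/andP[-> _] //|_].
by case: ifP => // _; apply: gnp_weight_ge0.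
Qed.

(** The complete graph alone has positive weight, even at [p = 1]. *)
Lemma sum_connected_gnp_weight_gt0 :
  0 < \sum_(G in connected_graphs N) gnp_weight p G.
Proof.
have /card_gt0P[T tT] := card_trees_gt0.
have allc : all_edges N \in connected_graphs N.
  by apply: (connected_graph_above _ tT (tree_edges tT)); rewrite inE.
rewrite (bigD1 (all_edges N)) //= ltr_wpDr //.
  by apply: sumr_ge0 => G _; apply: gnp_weight_ge0.
by rewrite /gnp_weight subnn expr0 mulr1 exprn_gt0.
Qed.

(** Exchanging sums, each splittable tree contributes at least the Jensen bound. Graphs containing a
    tree are connected, so the conditioning only divides by a number in [(0, 1]]. *)
Lemma split_prob_N_ge k :
  #|split_trees N k|%:R / #|trees N|%:R * expR (2 - 2 / p) <= split_prob_N N k p.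
Proof.
have den0 := sum_connected_gnp_weight_gt0.
have den1 := sum_connected_gnp_weight_le1.
have -> : expR (2 - 2 / p) = (expR (2 * (p^-1 - 1)))^-1.
  by rewrite -expRN; congr expR; ring.
rewrite /split_prob_N.
set num := \sum_(G in _) _ * _; set den := \sum_(G in _) _ in den0 den1 *.
have numE : num = \sum_(T in split_trees N k)
    \sum_(G in graphs N | T \subset G) gnp_weight p G / (tau G)%:R.
  rewrite (exchange_big_dep (mem (connected_graphs N))) /=; last first.
    move=> T G; rewrite inE => /andP[tT _] /andP[Gg sTG].
    exact: connected_graph_above Gg tT sTG.
  apply: eq_bigr => G; rewrite inE => /andP[Gg _].
  have sG : G \subset all_edges N by rewrite inE in Gg.
  rewrite sumr_const -[RHS]mulr_natr -[RHS]mulrA [_^-1 * _]mulrC (tau_kE k sG).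
  congr (_ * (_%:R / _)).
  by apply: eq_card => T; rewrite [LHS]inE [RHS]unfold_in Gg.
have num_ge : #|split_trees N k|%:R / #|trees N|%:R * (expR (2 * (p^-1 - 1)))^-1 <= num.
  rewrite numE -mulrA -invfM mulr_natl -sumr_const; apply: ler_sum => T.
  by rewrite inE => /andP[tT _]; apply: sum_gnp_weight_div_tau_ge.
apply: (le_trans num_ge); rewrite ler_pdivlMr // ler_piMr //.
rewrite numE; apply: sumr_ge0 => T _; apply: sumr_ge0 => G _.
by rewrite mulr_ge0 ?gnp_weight_ge0 ?invr_ge0.
Qed.

End Probability.

(** * Multinomial coefficients and conclusion *)

Lemma fact_addn_prod a k : ((a + k)`! = a`! * \prod_(i < k) (a + i.+1))%N.
Proof.
elim: k => [|k IH]; first by rewrite addn0 big_ord0 muln1.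
by rewrite big_ord_recr /= mulnA -IH addnS factS mulnC.
Qed.

(* Pair the factors [a + j] and [a + k.+1 - j]. *)
Lemma prod_pairing_ge a k :
  ((a * (a + k.+1)) ^ k <= (\prod_(i < k) (a + i.+1)) ^ 2)%N.
Proof.
rewrite -mulnn {2}(reindex_inj rev_ord_inj) /= -big_split /=.
rewrite -[k in X in (X <= _)%N]card_ord -prod_nat_const.
apply: leq_prod => -[i ik] _ /=; rewrite card_ord -{1}(subnKC ik).
move: (k - i.+1)%N => d.
have -> : ((a + i.+1) * (a + d.+1) = a * (a + (i.+1 + d).+1) + i.+1 * d.+1)%N by ring.
exact: leq_addr.
Qed.

Lemma leq_sqr_step X Y P Q K s t : (X ^ 2 <= Y ^ 2 * s)%N ->
  (s * P ^ 2 <= Q ^ 2 * t)%N -> ((X * (P * K)) ^ 2 <= (Y * (Q * K)) ^ 2 * t)%N.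
Proof.
move=> le1 le2; rewrite !expnMn.
apply: leq_trans (leq_mul le1 (leqnn _)) _.
have -> : (Y ^ 2 * s * (P ^ 2 * K ^ 2) = Y ^ 2 * K ^ 2 * (s * P ^ 2))%N by ring.
have -> : (Y ^ 2 * (Q ^ 2 * K ^ 2) * t = Y ^ 2 * K ^ 2 * (Q ^ 2 * t))%N by ring.
by rewrite leq_mul2l le2 orbT.
Qed.

(* The central multinomial coefficient [c(n)] has [c(n)^2 n^(k-1) k^(-2kn)]
   nondecreasing in [n >= 1]. *)
Lemma multinomial_sqr_ge k n : (0 < n)%N ->
  ((k.+1`! * (n`! ^ k.+1 * k.+1 ^ (k.+1 * n))) ^ 2 <=
   ((k.+1 * n)`! * k.+1 ^ k.+1) ^ 2 * n ^ k)%N.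
Proof.
case: n => // n _; elim: n => [|n IH]; first by rewrite !muln1 !exp1n mul1n muln1.
set K := (k.+1 * n.+2)%N; set a := (k.+1 * n.+1)%N in IH *.
have Ka : K = (a + k.+1)%N by rewrite /K /a mulnS addnC.
have pair := prod_pairing_ge a k; set Q := (\prod_(i < k) (a + i.+1))%N in pair *.
have -> : (k.+1`! * (n.+2`! ^ k.+1 * k.+1 ^ K) =
   k.+1`! * (n.+1`! ^ k.+1 * k.+1 ^ a) * K ^ k.+1)%N.
  have -> : (k.+1 ^ K = k.+1 ^ a * k.+1 ^ k.+1)%N by rewrite Ka expnD.
  rewrite [(K ^ _)%N]expnMn [n.+2`!]factS [((n.+2 * _) ^ _)%N]expnMn.
  by move: (k.+1 ^ k.+1)%N (k.+1 ^ a)%N (n.+1`! ^ _)%N (n.+2 ^ _)%N (k.+1`!)%N => *; ring.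
have -> : (K`! = a`! * (Q * K))%N by rewrite Ka fact_addn_prod big_ord_recr.
rewrite [(K ^ k.+1)%N]expnSr [(a`! * _ * _)%N]mulnAC; apply: leq_sqr_step IH _.
(* What remains after pairing is an equality, since [n.+1 * K = a * n.+2]. *)
apply: leq_trans (leq_mul pair (leqnn _)).
rewrite -Ka expnAC -!expnMn leq_eqVlt; apply/orP; left; apply/eqP.
by congr (_ ^ _)%N; rewrite /K /a; ring.
Qed.

Section Final.
Variable R : realType.

Lemma ler_div_sqr (A B F x y t : R) : 0 < F -> 0 < x -> 0 < y -> 0 < t ->
  (A * (F * y)) ^+ 2 <= (B * x) ^+ 2 * t -> (A / x) ^+ 2 / t <= (B / F / y) ^+ 2.
Proof.
move=> F0 x0 y0 t0 H; set d := (x * F * y) ^+ 2 * t.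
have d0 : 0 < d by rewrite mulr_gt0 // exprn_gt0 // !mulr_gt0.
have -> : (A / x) ^+ 2 / t = (A * (F * y)) ^+ 2 / d.
  by rewrite /d; field; rewrite !gt_eqF.
have -> : (B / F / y) ^+ 2 = (B * x) ^+ 2 * t / d.
  by rewrite /d; field; rewrite !gt_eqF.
by rewrite ler_pM2r ?invr_gt0.
Qed.

(** The right side is the probability that a uniform labelling is balanced. Squaring turns the
    half-integer power of [n] into an integer one. *)
Lemma labellings_ratio_ge k n : (0 < k)%N -> (0 < n)%N ->
  (k`!%:R / k%:R ^+ k : R) * n%:R `^ ((1 - k%:R) / 2) <=
  #|labellings k n|%:R / k%:R ^+ (k * n).
Proof.
case: k => // k _ n0; have nR : 0 < (n%:R : R) by rewrite ltr0n.
have kR : 0 < (k.+1%:R : R) by rewrite ltr0n.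
rewrite -ler_sqr ?nnegrE ?mulr_ge0 ?powR_ge0 ?invr_ge0 ?exprn_ge0 ?ler0n //.
have -> : ((k.+1`!%:R / k.+1%:R ^+ k.+1 : R) * n%:R `^ ((1 - k.+1%:R) / 2)) ^+ 2 =
  (k.+1`!%:R / k.+1%:R ^+ k.+1) ^+ 2 / n%:R ^+ k.
  rewrite exprMn; congr (_ * _); rewrite -powR_mulrn ?powR_ge0 // -powRrM.
  rewrite mulfVK // -[in X in 1 - X]addn1 natrD opprD addrCA subrr addr0 powRN.
  by rewrite powR_mulrn // ltW.
have f0 : 0 < (n`!%:R : R) by rewrite ltr0n fact_gt0.
have -> : (#|labellings k.+1 n|%:R : R) = (k.+1 * n)`!%:R / n`!%:R ^+ k.+1.
  by rewrite -card_labellings natrM natrX mulfK // expf_neq0 // gt_eqF.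
have := multinomial_sqr_ge k n0; rewrite -(ler_nat R) !(natrM, natrX).
by apply: ler_div_sqr; rewrite ?exprn_gt0.
Qed.

Lemma split_prob_ge k n (p : R) : (0 < k)%N -> (0 < n)%N -> 0 < p -> p <= 1 ->
  k`!%:R / k%:R ^+ k * n%:R `^ ((1 - k%:R) / 2) * expR (2 - 2 / p) <=
  split_prob k n p.
Proof.
move=> k0 n0 p0 p1; have N0 : (0 < k * n)%N by rewrite muln_gt0 k0.
apply: le_trans (split_prob_N_ge N0 p0 p1 k).
apply: ler_wpM2r; first exact: expR_ge0.
apply: le_trans (labellings_ratio_ge k0 n0) _.
have t0 := card_trees_gt0 N0.
rewrite ler_pdivrMr ?exprn_gt0 ?ltr0n // mulrAC ler_pdivlMr ?ltr0n //.
rewrite -natrX -!natrM ler_nat.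
(* This factor clears the denominators of Cayley's formula and of the bound on splittable trees,
   leaving the latter times [k ^ (k * n)]. *)
rewrite -(leq_pmul2r (m := n ^ (k * n) * (k * n) ^ 2)); last first.
  by rewrite muln_gt0 !expn_gt0 n0 N0.
rewrite mulnACA card_trees // [(n ^ _ * _)%N in leqRHS]mulnC [leqRHS]mulnACA.
by rewrite -expnMn leq_mul2r card_split_trees_ge ?orbT.
Qed.

End Final.

Local Open Scope classical_set_scope.

Theorem theorem5 (R : realType) (k : nat) (hk : (2 <= k)%N) :
  exists C : R, 0 < C /\
  forall (c : R) (p : nat -> R), 0 < c ->
    (\forall n \near \oo, c / ln (n%:R) <= p n /\ p n <= 1) ->
    (exists eps : nat -> R, eps @ \oo --> 0 /\
       \forall n \near \oo,
         C * (n%:R `^ ((1 - k%:R) / 2)) * p n * expR (- (2 + eps n) / p n)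
           <= split_prob k n (p n))
    /\
    (exists D : R, \forall n \near \oo,
         C * (n%:R `^ (- (k%:R / 2) - D)) <= split_prob k n (p n)).
Proof.
have k0 : (0 < k)%N by apply: leq_trans hk.
exists (k`!%:R / k%:R ^+ k); split.
  by rewrite divr_gt0 ?exprn_gt0 ?ltr0n ?fact_gt0.
move=> c p c0 hp.
have near2 : \forall n \near \oo,
    [/\ (1 < n)%N, c / ln (n%:R) <= p n, p n <= 1 & 0 < p n].
  near=> n.
  have n1 : (1 < n)%N by near: n; exists 2%N.
  have [h1 h2] : c / ln (n%:R) <= p n /\ p n <= 1 by near: n.
  split=> //; apply: lt_le_trans h1; apply: divr_gt0 => //.
  by rewrite ln_gt0 // ltr1n.
split.
  exists (fun=> 0); split; first exact: (@cvg_cst R^o).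
  near=> n.
  have [n1 _ p1 p0] : [/\ (1 < n)%N, c / ln (n%:R) <= p n, p n <= 1 & 0 < p n].
    by near: n.
  apply: le_trans (split_prob_ge k0 (ltnW n1) p0 p1); rewrite -mulrA.
  apply: ler_wpM2l.
    by rewrite mulr_ge0 ?powR_ge0 // divr_ge0 ?exprn_ge0 ?ler0n.
  (* The factor [p n] is absorbed by the constant [expR 2], as [p n <= 1 <= expR 2]. *)
  rewrite addr0 expRD mulNr ler_wpM2r ?expR_ge0 //; apply: (le_trans p1).
  by rewrite -expR0 ler_expR.
(* From [c / ln n <= p n] follows [2 / p n <= (2 / c) ln n], so the exponential costs at most the
   power [2 / c] of [n]. *)
exists (2 / c); near=> n.
have [n1 lep p1 p0] : [/\ (1 < n)%N, c / ln (n%:R) <= p n, p n <= 1 & 0 < p n].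
  by near: n.
have nR : 1 < (n%:R : R) by rewrite ltr1n.
apply: le_trans (split_prob_ge k0 (ltnW n1) p0 p1); rewrite -mulrA.
apply: ler_wpM2l; first by rewrite divr_ge0 ?exprn_ge0 ?ler0n.
have n0 : (n%:R : R) != 0 by rewrite gt_eqF // (lt_trans _ nR).
apply: le_trans (_ : n%:R `^ ((1 - k%:R) / 2 - 2 / c) <= _).
  by apply: ler_powR; [exact: ltW | lra].
rewrite powRD ?n0 ?implybT //; apply: ler_wpM2l; first exact: powR_ge0.
rewrite /powR (negPf n0) ler_expR.
apply: le_trans (_ : - (2 / p n) <= _); last by lra.
rewrite mulNr lerN2 mulrAC ler_pdivlMr // mulrAC ler_pdivrMr //.
by rewrite -mulrA ler_wpM2l // mulrC -ler_pdivrMr // ln_gt0.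
Unshelve. all: by end_near.
Qed.
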